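(* Let $p=p(n)\in(0,1)$ satisfy $p\to0$ and $n^{1/2}p\to\infty$ as $n\to\infty$, and let $\delta=\delta_n>0$ be a bounded sequence such that $\delta_n np/n^{1/2}\to\infty$. Then, as $n\to\infty$, $$\phi_2(n,p,\delta np)=(1+o(1))\,\tfrac12\,\delta^2n^2p^2\log(1/p),$$ and, under the same conditions on $p$ and $\delta$, $$\lim_{n\to\infty}\frac{-\log\mathbb{P}\big(\|A(\mathcal{G}_{n,p})-p\mathbf 1\mathbf 1'\|_{\mathrm{op}}\ge\delta np\big)}{\tfrac12\delta^2n^2p^2\log(1/p)}=1.$$
   Context: $\mathcal{G}_{n,p}$ is the Erdős–Rényi random graph on $n$ vertices with edge probability $p$ (independent edges), $A(\mathcal{G}_{n,p})$ is its adjacency matrix, $\mathbf 1\in\mathbb{R}^n$ is the all-ones column vector, $'$ denotes transpose, and $\|M\|_{\mathrm{op}}=\sup_{\|x\|=1}\|Mx\|$ (Euclidean norm) for a symmetric matrix $M$. $\mathscr{G}_n$ denotes the set of weighted undirected graphs $G_n$ on $n$ vertices with adjacency matrix $A(G_n)=(a_{ij})_{1\le i,j\le n}$ satisfying $0\le a_{ij}\le 1$, $a_{ij}=a_{ji}$ and $a_{ii}=0$ for all $i,j$. For $x\in[0,1]$, $I_p(x)=x\log\frac xp+(1-x)\log\frac{1-x}{1-p}$ (with $0\log 0=0$), and $I_p(G_n)=\sum_{1\le i<j\le n}I_p(a_{ij})$. For $\theta>0$, $$\phi_2(n,p,\theta)=\inf\{I_p(G_n): G_n\in\mathscr{G}_n,\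 \|A(G_n)-p\mathbf 1\mathbf 1'\|_{\mathrm{op}}\ge\theta\}.$$ *)

(* Defs.v *)
From mathcomp Require Import all_boot all_order all_algebra.
From mathcomp Require Import all_classical all_reals all_analysis.

Set Implicit Arguments.
Unset Strict Implicit.
Unset Printing Implicit Defensive.

Import Order.TTheory GRing.Theory Num.Theory.
Import numFieldNormedType.Exports.

Local Open Scope classical_set_scope.
Local Open Scope ring_scope.

(* MathComp-Analysis's norm `|x| on matrices is the max norm, hence l2norm. *)
Definition l2norm (R : realType) (n : nat) (x : 'cV[R]_n) : R :=
  Num.sqrt (\sum_(i < n) x i 0 ^+ 2).

Definition op_norm (R : realType) (n : nat) (M : 'M[R]_n) : R :=
  sup [set l2norm (M *m x) | x in [set x : 'cV[R]_n | l2norm x = 1]].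

Definition deviation (R : realType) (n : nat) (p : R) (A : 'M[R]_n) : R :=
  op_norm (A - p *: (const_mx 1 *m (const_mx 1 : 'cV[R]_n)^T)).

Definition weighted_graphs (R : realType) (n : nat) : set 'M[R]_n :=
  [set A | [/\ forall i j, 0 <= A i j <= 1,
               forall i j, A i j = A j i &
               forall i, A i i = 0]].

(* The convention 0 log 0 = 0 holds because the vanishing factor multiplies a
   total logarithm. *)
Definition Ip (R : realType) (p x : R) : R :=
  x * ln (x / p) + (1 - x) * ln ((1 - x) / (1 - p)).

Definition Ip_graph (R : realType) (n : nat) (p : R) (A : 'M[R]_n) : R :=
  \sum_(i < n) \sum_(j < n | (i < j)%N) Ip p (A i j).

(* Extended-real valued, so that the infimum of the empty set is +oo. *)
Definition phi2 (R : realType) (n : nat) (p theta : R) : \bar R :=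
  ereal_inf [set (Ip_graph p A)%:E | A in
    [set A : 'M[R]_n | weighted_graphs A /\ theta <= deviation p A]].

(* Simple graphs on 'I_n are represented by boolean adjacency matrices. *)
Definition simple_graph (n : nat) (g : 'M[bool]_n) : bool :=
  (g^T == g) && [forall i, ~~ g i i].

Definition adjacency (R : realType) (n : nat) (g : 'M[bool]_n) : 'M[R]_n :=
  map_mx (fun b : bool => b%:R) g.

(* G(n,p) is the law under which the edge indicators g i j, i < j, are
   independent Bernoulli(p): the mass of a graph is a product over pairs. *)
Definition Gnp_pmf (R : realType) (n : nat) (p : R) (g : 'M[bool]_n) : R :=
  \prod_(i < n) \prod_(j < n | (i < j)%N) bernoulli_pmf p (g i j).

Definition Gnp_prob (R : realType) (n : nat) (p : R) (E : set 'M[bool]_n) : R :=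
  \sum_(g : 'M[bool]_n | simple_graph g && (g \in E)) Gnp_pmf p g.

Definition rate (R : realType) (n : nat) (p delta : R) : R :=
  2^-1 * delta ^+ 2 * n%:R ^+ 2 * p ^+ 2 * ln (p^-1).

(* Main.v *)
(** Both quantities are governed by one inequality: for small [p] the relative
    entropy satisfies [I_p(q) >= k (q - p)^2] with [k = (1 - o(1)) log(1/p)].
    Since the operator norm is at most the Hilbert-Schmidt norm, this gives the
    lower bound for [phi2] at once.  Dually, it says that a centred
    Bernoulli(p) variable is sub-Gaussian with variance proxy [1/(2k)], so that
    for unit vectors [y], [x] the bilinear form [y'(A - p11')x], whose edge
    coefficients have squared sum at most 2, exceeds [t] with probability at
    most [exp(-k t^2 / 2)], up to the diagonal.  A union bound over a net of
    [exp(O(n))] lattice vectors costs a negligible factor, because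
    [delta n p >> sqrt n].  Conversely, planting a clique on
    [(1 + o(1)) delta n p] vertices forces the deviation and costs
    [s^2/2 log(1/p)], both in [I_p] and in probability. *)

Require Import Defs.
From mathcomp Require Import all_boot all_order all_algebra.
From mathcomp Require Import all_classical all_reals all_analysis.
From mathcomp Require Import ring lra.
Set Implicit Arguments.
Unset Strict Implicit.
Unset Printing Implicit Defensive.
Import Order.TTheory GRing.Theory Num.Theory.
Import numFieldNormedType.Exports.
Local Open Scope classical_set_scope.
Local Open Scope ring_scope.

(** * Relative entropy and moment generating function *)

Lemma ln_le_subr1 (R : realType) (x : R) : 0 < x -> ln x <= x - 1.
Proof.
move=> x0; rewrite -[x in ln x](subrK 1) addrC; apply: le_ln1Dx.
by rewrite ltrBrDr addNr.
Qed.

Lemma mulr_ln_div_ge (R : realType) (x y : R) : 0 <= x -> 0 < y ->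
  x - y <= x * ln (x / y).
Proof.
move=> x0 y0; have [->|xn0] := eqVneq x 0; first by rewrite mul0r sub0r oppr_le0 ltW.
have xp : 0 < x by rewrite lt_neqAle eq_sym xn0.
have -> : ln (x / y) = - ln (y / x) by rewrite -lnV ?posrE ?divr_gt0// invf_div.
rewrite mulrN lerNr opprB.
have := ln_le_subr1 (divr_gt0 y0 xp) => /(ler_wpM2l x0) /le_trans; apply.
by rewrite mulrBr mulr1 mulrC divfK.
Qed.

(** The second summand of [Ip] is at least [(1 - q) - (1 - p) = p - q] by [mulr_ln_div_ge]; the
    summand that can be large is kept exactly. *)
Lemma Ip_ge (R : realType) (p q : R) : 0 < p < 1 -> 0 <= q <= 1 ->
  q * ln (q / p) - q + p <= Ip p q.
Proof.
move=> /andP[p0 p1] /andP[q0 q1]; rewrite /Ip -addrA lerD2l.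
apply: le_trans (mulr_ln_div_ge _ _); rewrite ?subr_ge0 ?subr_gt0//; lra.
Qed.

(* [ln u <= 2 (sqrt u - 1)] turns the relative entropy into a Hellinger
   distance. *)
Lemma Ip_ge_hellinger (R : realType) (p q : R) : 0 < p < 1 -> 0 <= q <= 1 ->
  (q - p) ^+ 2 / (2 * (q + p)) <= Ip p q.
Proof.
move=> p01 q01; apply: le_trans (Ip_ge p01 q01).
move: p01 q01 => /andP[p0 p1] /andP[q0 q1].
set a := Num.sqrt p; set b := Num.sqrt q.
have a0 : 0 < a by rewrite sqrtr_gt0.
have b0 : 0 <= b by rewrite sqrtr_ge0.
have pE : p = a ^+ 2 by rewrite sqr_sqrtr// ltW.
have qE : q = b ^+ 2 by rewrite sqr_sqrtr.
have key : 2 * b * (b - a) <= q * ln (q / p).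
  have -> : ln (q / p) = 2 * ln (b / a).
    (* At [q = 0] both logarithms take the default value [ln 0 = 0]. *)
    have [b00|bn0] := eqVneq b 0; first by rewrite qE b00 expr0n !mul0r ln0// mulr0.
    rewrite qE pE -expr_div_n lnXn ?mulr_natl// divr_gt0// lt_neqAle eq_sym bn0//.
  have := mulr_ln_div_ge b0 a0 => /(ler_wpM2l (mulr_ge0 (ler0n R 2) b0)).
  by rewrite qE; congr (_ <= _); ring.
apply: le_trans (_ : (b - a) ^+ 2 <= _); last by rewrite qE pE in key *; nra.
have s0 : 0 < q + p by rewrite ltr_wpDl.
rewrite ler_pdivrMr ?mulr_gt0// qE pE.
have -> : (b ^+ 2 - a ^+ 2) ^+ 2 = (b - a) ^+ 2 * (b + a) ^+ 2 by ring.
by rewrite ler_wpM2l ?sqr_ge0//; have := sqr_ge0 (b - a); nra.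
Qed.

(** The argument splits at [q = 1 / (4k)]. Below it, [2 (q + p) <= 1 / k] and the Hellinger bound
    suffices. Above it, [ln (q / p) >= ln p^-1 - ln (4k) >= k + 1], so the entropy is at least
    [k q], while [(q - p)^2 <= q]. *)
Lemma Ip_ge_sqr (R : realType) (p q k : R) : 0 < p < 1 -> 0 <= q <= 1 ->
  0 < k -> 4 * k * p <= 1 -> k + ln (4 * k) + 1 <= ln p^-1 ->
  k * (q - p) ^+ 2 <= Ip p q.
Proof.
move=> p01 q01 k0 kp kL; move: (p01) (q01) => /andP[p0 p1] /andP[q0 q1].
have [qs|qb] := leP (4 * k * q) 1.
  apply: le_trans (Ip_ge_hellinger p01 q01).
  have s0 : 0 < q + p by rewrite ltr_wpDl.
  rewrite ler_pdivlMr ?mulr_gt0// mulrAC mulrC -[leRHS]mulr1.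
  by rewrite ler_wpM2l ?sqr_ge0//; nra.
have qp : 0 < q by nra.
have pq : p <= q by nra.
apply: le_trans (Ip_ge p01 q01).
have lnq : - ln (4 * k) <= ln q.
  rewrite -lnV ?posrE ?mulr_gt0// ler_ln ?posrE ?invr_gt0 ?mulr_gt0//.
  by rewrite -div1r ler_pdivrMr ?mulr_gt0//; lra.
rewrite lnM ?posrE ?invr_gt0//.
have : q * (k + 1) <= q * (ln q + ln p^-1) by rewrite ler_wpM2l//; lra.
have : (q - p) ^+ 2 <= q by nra.
by move=> /(ler_wpM2l (ltW k0)); nra.
Qed.

(** The logarithm of the left side equals [s (q - p) - Ip p q] at the tilted mean [q]. The quadratic
    lower bound on [Ip] reduces this to the maximum of [s u - k u^2] over real [u], which is
    [s^2 / (4k)]. *)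
Lemma bernoulli_mgf_le (R : realType) (p k s : R) : 0 < p < 1 -> 0 < k ->
  (forall q, 0 <= q <= 1 -> k * (q - p) ^+ 2 <= Ip p q) ->
  p * expR (s * (1 - p)) + (1 - p) * expR (s * (0 - p)) <=
    expR (s ^+ 2 / (4 * k)).
Proof.
move=> p01 k0 H; move: (p01) => /andP[p0 p1].
set Z := p * expR s + (1 - p).
have es0 := expR_gt0 s.
have Z0 : 0 < Z by rewrite addr_gt0 ?mulr_gt0 ?subr_gt0.
(* The tilted mean [q] attains equality in Gibbs' variational principle. *)
pose q := p * expR s / Z.
have q1E : 1 - q = (1 - p) / Z by rewrite /q /Z; field; rewrite gt_eqF.
have q01 : 0 <= q <= 1.
  rewrite divr_ge0 ?mulr_ge0 ?(ltW p0) ?(ltW es0) ?(ltW Z0)//=.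
  by rewrite -subr_ge0 q1E divr_ge0 ?subr_ge0 ?ltW.
have -> : p * expR (s * (1 - p)) + (1 - p) * expR (s * (0 - p)) =
    expR (ln Z - s * p).
  rewrite expRB lnK ?posrE// mulrBr mulr1 sub0r mulrN expRB expRN /Z.
  by field; rewrite gt_eqF ?expR_gt0.
have IE : Ip p q = s * q - ln Z.
  rewrite /Ip q1E.
  have -> : q / p = expR s / Z by rewrite /q; field; rewrite !gt_eqF.
  have -> : (1 - p) / Z / (1 - p) = Z^-1 by field; rewrite !gt_eqF ?subr_gt0.
  rewrite ln_div ?posrE// expRK lnV ?posrE// -q1E; ring.
have := H q q01; rewrite IE => Hq.
rewrite ler_expR.
apply: le_trans (_ : s * (q - p) - k * (q - p) ^+ 2 <= _); first lra.
rewrite ler_pdivlMr ?mulr_gt0//.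
by have := sqr_ge0 (s - 2 * k * (q - p)); nra.
Qed.

(** * Operator norm *)

(** Lagrange's identity: the sum of all [(a i * b j - a j * b i) ^+ 2] is twice the defect in the
    inequality. *)
Lemma sum_cauchy_schwarz (R : realType) (I : finType) (a b : I -> R) :
  (\sum_i a i * b i) ^+ 2 <= (\sum_i a i ^+ 2) * (\sum_i b i ^+ 2).
Proof.
have : 0 <= \sum_i \sum_j (a i * b j - a j * b i) ^+ 2.
  by apply: sumr_ge0 => i _; apply: sumr_ge0 => j _; exact: sqr_ge0.
have -> : \sum_i \sum_j (a i * b j - a j * b i) ^+ 2 =
    2 * ((\sum_i a i ^+ 2) * (\sum_i b i ^+ 2) - (\sum_i a i * b i) ^+ 2).
  have sumM (u v : I -> R) :
      (\sum_i u i) * (\sum_i v i) = \sum_i \sum_j u i * v j.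
    by rewrite mulr_suml; apply: eq_bigr => i _; rewrite mulr_sumr.
  rewrite mulrBr expr2 !sumM mulr2n mulrDl mul1r.
  rewrite [X in _ + X - _]exchange_big/= mulr_sumr -big_split -sumrB/=.
  apply: eq_bigr => i _; rewrite mulr_sumr -big_split -sumrB/=.
  by apply: eq_bigr => j _; ring.
by rewrite pmulr_rge0// subr_ge0.
Qed.

Definition dotp (R : realType) (n : nat) (y x : 'cV[R]_n) : R :=
  \sum_i y i 0 * x i 0.

Lemma l2norm_sqr (R : realType) (n : nat) (x : 'cV[R]_n) :
  l2norm x ^+ 2 = \sum_i x i 0 ^+ 2.
Proof. by rewrite sqr_sqrtr//; apply: sumr_ge0 => i _; exact: sqr_ge0. Qed.

Lemma l2norm_ge0 (R : realType) (n : nat) (x : 'cV[R]_n) : 0 <= l2norm x.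
Proof. exact: sqrtr_ge0. Qed.

Lemma l2norm0 (R : realType) (n : nat) : l2norm (0 : 'cV[R]_n) = 0.
Proof.
by rewrite /l2norm big1 ?sqrtr0// => i _; rewrite mxE expr0n.
Qed.

Lemma l2norm_eq0 (R : realType) (n : nat) (x : 'cV[R]_n) : l2norm x = 0 -> x = 0.
Proof.
move=> x0; have := l2norm_sqr x; rewrite x0 expr0n/= => /esym/eqP.
rewrite psumr_eq0 => [/allP H|i _]; last exact: sqr_ge0.
apply/colP => i; rewrite mxE.
by have := H i (mem_index_enum _); rewrite sqrf_eq0 => /eqP.
Qed.

Lemma l2normZ (R : realType) (n : nat) (a : R) (x : 'cV[R]_n) :
  l2norm (a *: x) = `|a| * l2norm x.
Proof.
rewrite /l2norm -sqrtr_sqr -sqrtrM ?sqr_ge0//; congr Num.sqrt.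
by rewrite mulr_sumr; apply: eq_bigr => i _; rewrite mxE exprMn.
Qed.

Lemma dotp_le (R : realType) (n : nat) (y x : 'cV[R]_n) :
  dotp y x <= l2norm y * l2norm x.
Proof.
apply: le_trans (ler_norm _) _.
rewrite -ler_sqr ?nnegrE ?normr_ge0 ?mulr_ge0 ?l2norm_ge0//.
by rewrite real_normK ?num_real// exprMn !l2norm_sqr sum_cauchy_schwarz.
Qed.

Lemma dotp_self (R : realType) (n : nat) (x : 'cV[R]_n) :
  dotp x x = l2norm x ^+ 2.
Proof. by rewrite l2norm_sqr; apply: eq_bigr => i _; rewrite expr2. Qed.

Lemma dotpBl (R : realType) (n : nat) (y z x : 'cV[R]_n) :
  dotp (y - z) x = dotp y x - dotp z x.
Proof. by rewrite -sumrB; apply: eq_bigr => i _; rewrite !mxE mulrBl. Qed.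

Lemma dotpBr (R : realType) (n : nat) (y z x : 'cV[R]_n) :
  dotp x (y - z) = dotp x y - dotp x z.
Proof. by rewrite -sumrB; apply: eq_bigr => i _; rewrite !mxE mulrBr. Qed.

Lemma dotpZl (R : realType) (n : nat) a (y x : 'cV[R]_n) :
  dotp (a *: y) x = a * dotp y x.
Proof. by rewrite mulr_sumr; apply: eq_bigr => i _; rewrite !mxE mulrA. Qed.

Lemma dotp_mulmx (R : realType) (n : nat) (M : 'M[R]_n) (y x : 'cV[R]_n) :
  dotp y (M *m x) = \sum_i \sum_j y i 0 * x j 0 * M i j.
Proof.
apply: eq_bigr => i _; rewrite mxE mulr_sumr.
by apply: eq_bigr => j _; ring.
Qed.

Definition hs_norm (R : realType) (n : nat) (M : 'M[R]_n) : R :=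
  Num.sqrt (\sum_i \sum_j M i j ^+ 2).

Lemma l2norm_mulmx_le (R : realType) (n : nat) (M : 'M[R]_n) (x : 'cV[R]_n) :
  l2norm (M *m x) <= hs_norm M * l2norm x.
Proof.
rewrite -sqrtrM; last by do 2![apply: sumr_ge0 => ? _]; exact: sqr_ge0.
apply: ler_wsqrtr; rewrite mulr_suml; apply: ler_sum => i _.
by rewrite mxE sum_cauchy_schwarz.
Qed.

Lemma op_norm_ub (R : realType) (n : nat) (M : 'M[R]_n) (x : 'cV[R]_n) :
  l2norm x = 1 -> l2norm (M *m x) <= op_norm M.
Proof.
move=> x1; apply: ub_le_sup; last by exists x.
(* The Hilbert-Schmidt norm bounds the set, so [sup] is a genuine supremum here. *)
by exists (hs_norm M) => _ [z /= z1 <-]; rewrite -[leRHS]mulr1 -z1 l2norm_mulmx_le.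
Qed.

Lemma l2norm_mulmx_op (R : realType) (n : nat) (M : 'M[R]_n) (x : 'cV[R]_n) :
  l2norm (M *m x) <= op_norm M * l2norm x.
Proof.
have [x0|xn0] := eqVneq (l2norm x) 0.
  by rewrite (l2norm_eq0 x0) mulmx0 l2norm0 mulr0.
have xp : 0 < l2norm x by rewrite lt_neqAle eq_sym xn0 l2norm_ge0.
have := @op_norm_ub R n M ((l2norm x)^-1 *: x).
rewrite -scalemxAr !l2normZ ger0_norm ?invr_ge0 ?l2norm_ge0// mulVf//.
by move=> /(_ erefl); rewrite mulrC ler_pdivrMr.
Qed.

Lemma dotp_mulmx_le (R : realType) (n : nat) (M : 'M[R]_n) (y x : 'cV[R]_n) :
  dotp y (M *m x) <= op_norm M * l2norm y * l2norm x.
Proof.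
rewrite (mulrC (op_norm M)) -mulrA; apply: le_trans (dotp_le _ _) _.
by rewrite ler_wpM2l ?l2norm_ge0// l2norm_mulmx_op.
Qed.

Lemma op_norm_le_hs (R : realType) (n : nat) (M : 'M[R]_n) :
  op_norm M <= hs_norm M.
Proof.
rewrite /op_norm; have [S0|/set0P S0] :=
  eqVneq [set l2norm (M *m x) | x in [set x : 'cV[R]_n | l2norm x = 1]] set0.
  (* In dimension 0 there is no unit vector and [sup] takes its default value 0. *)
  by rewrite S0 sup0 sqrtr_ge0.
apply: ge_sup => // _ [z /= z1 <-].
by rewrite -[leRHS]mulr1 -z1 l2norm_mulmx_le.
Qed.

Lemma op_norm_approx (R : realType) (n : nat) (M : 'M[R]_n) (c : R) :
  0 <= c < op_norm M ->
  exists y x : 'cV[R]_n, [/\ l2norm y = 1, l2norm x = 1 &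
    c < dotp y (M *m x)].
Proof.
move=> /andP[c0 cM].
have hs : has_sup [set l2norm (M *m x) | x in [set x : 'cV[R]_n | l2norm x = 1]].
  (* Without a supremum, [op_norm M] would be the default 0, which does not exceed [c >= 0]. *)
  apply: contrapT => /sup_out H; move: cM; rewrite /op_norm H => cM.
  by have := le_lt_trans c0 cM; rewrite ltxx.
have [_ [x /= x1 <-] cx] := sup_gt (proj1 hs) cM.
have Mp := le_lt_trans c0 cx.
exists ((l2norm (M *m x))^-1 *: (M *m x)), x; split => //.
  by rewrite l2normZ ger0_norm ?invr_ge0 ?l2norm_ge0// mulVf// gt_eqF.
by rewrite dotpZl dotp_self expr2 mulKf// gt_eqF.
Qed.

Lemma le_op_norm_of_dotp (R : realType) (n : nat) (M : 'M[R]_n) (y x : 'cV[R]_n) :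
  l2norm y = 1 -> l2norm x = 1 -> dotp y (M *m x) <= op_norm M.
Proof. by move=> y1 x1; have := dotp_mulmx_le M y x; rewrite y1 x1 !mulr1. Qed.

(** One [e] is lost in choosing a nearly optimal pair of unit vectors, and one more in rounding each
    of them, since every rounding error enters the bilinear form multiplied by at most
    [op_norm M]. *)
Lemma op_norm_round (R : realType) (n : nat) (M : 'M[R]_n) (e : R)
    (rnd : 'cV[R]_n -> 'cV[R]_n) :
  0 < e -> e <= 1 -> 0 < op_norm M ->
  (forall x, l2norm x = 1 -> l2norm (x - rnd x) <= e /\ l2norm (rnd x) <= 1) ->
  exists y x : 'cV[R]_n, [/\ l2norm y = 1, l2norm x = 1 &
    (1 - 3 * e) * op_norm M <= dotp (rnd y) (M *m rnd x)].
Proof.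
move=> e0 e1 M0 H.
have [|y [x [y1 x1 Hc]]] := @op_norm_approx R n M ((1 - e) * op_norm M).
  by apply/andP; split; nra.
exists y, x; split => //; have [xe xr] := H _ x1; have [ye yr] := H _ y1.
have : dotp y (M *m x) - dotp (rnd y) (M *m rnd x) =
    dotp (y - rnd y) (M *m x) + dotp (rnd y) (M *m (x - rnd x)).
  by rewrite mulmxBr dotpBl dotpBr; ring.
have le_Me (u v : 'cV[R]_n) : l2norm u * l2norm v <= e ->
    dotp u (M *m v) <= op_norm M * e.
  move=> uv; apply: le_trans (dotp_mulmx_le M u v) _.
  by rewrite -mulrA ler_wpM2l// ltW.
have := le_Me (y - rnd y) x; rewrite x1 mulr1 => /(_ ye).
have : l2norm (rnd y) * l2norm (x - rnd x) <= e.
  by apply: le_trans xe; rewrite ler_piMl ?l2norm_ge0.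
by move=> /le_Me; lra.
Qed.

Lemma sum_triangle (R : realType) (n : nat) (f : 'I_n -> 'I_n -> R) :
  \sum_i \sum_j f i j =
    \sum_(i < n) \sum_(j < n | (i < j)%N) (f i j + f j i) + \sum_i f i i.
Proof.
transitivity (\sum_(i < n) (\sum_(j < n | (i < j)%N) f i j +
    (\sum_(j < n | (j < i)%N) f i j + f i i))).
  apply: eq_bigr => i _; rewrite (bigID (fun j : 'I_n => (i < j)%N))/=.
  congr (_ + _); rewrite (bigD1 i) ?ltnn//= addrC; congr (_ + _).
  by apply: eq_bigl => j; rewrite -leqNgt ltn_neqAle andbC.
rewrite big_split big_split/= addrA; congr (_ + _).
rewrite [X in _ + X = _](exchange_big_dep predT)//= -big_split/=.
by apply: eq_bigr => i _; rewrite -big_split.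
Qed.

(** * Exponential moments of the random graph *)

(** Independence of the edges in product form: a simple graph is a free choice of one boolean per
    pair [i < j], so the sum factorizes by distributivity. *)
Lemma sum_simple_graph_prod (R : realType) (n : nat)
    (F : 'I_n -> 'I_n -> bool -> R) :
  \sum_(g : 'M[bool]_n | simple_graph g)
      \prod_(i < n) \prod_(j < n | (i < j)%N) F i j (g i j) =
  \prod_(i < n) \prod_(j < n | (i < j)%N) (F i j true + F i j false).
Proof.
pose P := fun q : 'I_n * 'I_n => (q.1 < q.2)%N.
have -> : \prod_(i < n) \prod_(j < n | (i < j)%N) (F i j true + F i j false) =
    \prod_(q | P q) \sum_(b : bool) F q.1 q.2 b.
  by rewrite pair_big_dep/=; apply: eq_bigr => q _; rewrite big_bool.
rewrite (big_distr_big_dep false).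
(* [h] symmetrizes a function supported on the strict upper triangle and [h'] restricts a graph to
   that triangle; they are mutually inverse between such functions and simple graphs. *)
pose h (f : {ffun 'I_n * 'I_n -> bool}) : 'M[bool]_n :=
  \matrix_(i, j) (f (i, j) || f (j, i)).
pose h' (g : 'M[bool]_n) : {ffun 'I_n * 'I_n -> bool} :=
  [ffun q => P q && g q.1 q.2].
rewrite (reindex_onto h h') => [|g /andP[/eqP gT /forallP g0]]; last first.
  apply/matrixP => i j; rewrite mxE !ffunE /P/=.
  have -> : g j i = g i j by rewrite -{1}gT mxE.
  have [//|//|] := ltngtP i j; rewrite ?orbF//.
  by move=> /val_inj ->; exact/esym/negbTE.
have supp (f : {ffun 'I_n * 'I_n -> bool}) :
    f \in pfamily false P (fun _ => predT) -> forall q, f q -> P q.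
  by move=> /familyP H q; have := H q; case: ifP => // _; rewrite inE => /eqP ->.
apply: eq_big => [f|f /andP[_ /eqP <-]]; last first.
  rewrite pair_big_dep/=; apply: eq_bigr => -[i j]; rewrite /P/= => ij.
  congr (F _ _ _); rewrite !mxE !ffunE /P/= ij ltnNge (ltnW ij)/= mxE.
  by rewrite orbF.
apply/andP/idP => [[_ /eqP <-]|Hf].
  apply/familyP => q; rewrite ffunE /=; case: ifP => //.
  by move=> Pq; have -> : P q = false by exact: Pq.
have {Hf}/supp Hf := Hf.
split.
  apply/andP; split.
    by apply/eqP/matrixP => i j; rewrite !mxE orbC.
  apply/forallP => i; rewrite mxE orbb; apply/negP => /Hf.
  by rewrite /P ltnn.
apply/eqP/ffunP => -[i j]; rewrite ffunE mxE /=.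
have [fij|/negP fij] := boolP (f (i, j)); first by rewrite (Hf _ fij).
have [fji|/negP fji] := boolP (f (j, i)); last by rewrite andbF; exact/esym/negP/negP.
by have := Hf _ fji; rewrite /P/= => ji; rewrite ltnNge (ltnW ji); exact/esym/negP.
Qed.

Lemma Gnp_pmf_ge0 (R : realType) (n : nat) (p : R) (g : 'M[bool]_n) :
  0 < p < 1 -> 0 <= Gnp_pmf p g.
Proof.
move=> /andP[p0 p1]; apply: prodr_ge0 => i _; apply: prodr_ge0 => j _.
by apply: bernoulli_pmf_ge0; rewrite !ltW.
Qed.

Lemma Gnp_prob_union (R : realType) (n : nat) (p b : R) (T : finType)
    (N : pred T) (E : set 'M[bool]_n) (F : T -> set 'M[bool]_n) :
  0 < p < 1 ->
  (forall g, simple_graph g -> E g -> exists2 t, N t & F t g) ->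
  (forall t, N t -> Gnp_prob p (F t) <= b) ->
  Gnp_prob p E <= #|N|%:R * b.
Proof.
move=> p01 sub Fb.
apply: (@le_trans _ _ (\sum_(t | N t) Gnp_prob p (F t))); last first.
  by rewrite mulr_natl -sumr_const; apply: ler_sum => t Nt; exact: Fb.
rewrite (exchange_big_dep (@simple_graph n))/= => [|t g _ /andP[]//].
rewrite /Gnp_prob big_mkcondr/=; apply: ler_sum => g gs.
have s0 (A : pred T) : 0 <= \sum_(t | A t) Gnp_pmf p g.
  by apply: sumr_ge0 => t _; exact: Gnp_pmf_ge0.
case: ifP => // /set_mem /(sub _ gs)[t Nt Ft].
rewrite (bigD1 t) ?lerDl//=; last by rewrite Nt gs/=; exact: mem_set.
Qed.

Lemma Gnp_chernoff (R : realType) (n : nat) (p k t : R)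
    (c : 'I_n -> 'I_n -> R) :
  0 < p < 1 -> 0 < k -> 0 <= t ->
  (forall q, 0 <= q <= 1 -> k * (q - p) ^+ 2 <= Ip p q) ->
  \sum_(i < n) \sum_(j < n | (i < j)%N) c i j ^+ 2 <= 2 ->
  Gnp_prob p [set g : 'M[bool]_n |
    t <= \sum_(i < n) \sum_(j < n | (i < j)%N) c i j * ((g i j)%:R - p)] <=
  expR (- (k * t ^+ 2 / 2)).
Proof.
move=> p01 k0 t0 H c2.
(* The exponential Markov inequality at parameter [l] leaves the exponent [l^2 / (2k) - l t], by the
   bound 2 on the squared coefficients; [k t] minimizes it. *)
pose l := k * t.
have l0 : 0 <= l by rewrite mulr_ge0// ltW.
apply: (@le_trans _ _ (\sum_(g : 'M[bool]_n | simple_graph g)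
    expR (- (l * t)) * \prod_(i < n) \prod_(j < n | (i < j)%N)
      (bernoulli_pmf p (g i j) * expR (l * c i j * ((g i j)%:R - p))))).
  rewrite /Gnp_prob big_mkcondr/=; apply: ler_sum => g _.
  have -> : \prod_(i < n) \prod_(j < n | (i < j)%N)
      (bernoulli_pmf p (g i j) * expR (l * c i j * ((g i j)%:R - p))) =
      Gnp_pmf p g * expR (l *
        \sum_(i < n) \sum_(j < n | (i < j)%N) c i j * ((g i j)%:R - p)).
    rewrite mulr_sumr expR_sum -big_split/=; apply: eq_bigr => i _.
    rewrite mulr_sumr expR_sum -big_split/=; apply: eq_bigr => j _.
    by rewrite mulrA.
  have g0 := Gnp_pmf_ge0 g p01.
  case: ifPn => [/set_mem /= tg|_]; last by rewrite !mulr_ge0 ?expR_ge0.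
  rewrite mulrCA ler_peMr// -expRD; apply: le_trans (expR_ge1Dx _).
  by rewrite lerDl addrC subr_ge0 ler_wpM2l.
rewrite -mulr_sumr.
rewrite (@sum_simple_graph_prod _ _
  (fun i j b => bernoulli_pmf p b * expR (l * c i j * (b%:R - p)))).
apply: (@le_trans _ _ (expR (- (l * t)) * \prod_(i < n) \prod_(j < n | (i < j)%N)
    expR ((l * c i j) ^+ 2 / (4 * k)))).
  rewrite ler_wpM2l ?expR_ge0//; move: (p01) => /andP[p0 p1].
  have f0 i j : 0 <= bernoulli_pmf p true * expR (l * c i j * (true%:R - p)) +
      bernoulli_pmf p false * expR (l * c i j * (false%:R - p)).
    by rewrite addr_ge0// mulr_ge0 ?expR_ge0// bernoulli_pmf_ge0// !ltW.
  apply: ler_prod => i _; rewrite prodr_ge0//=.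
  by apply: ler_prod => j _; rewrite f0/= bernoulli_mgf_le.
under eq_bigr do rewrite -expR_sum.
rewrite -expR_sum -expRD ler_expR.
have -> : \sum_(i < n) \sum_(j < n | (i < j)%N) (l * c i j) ^+ 2 / (4 * k) =
    (l ^+ 2 / (4 * k)) * \sum_(i < n) \sum_(j < n | (i < j)%N) c i j ^+ 2.
  rewrite mulr_sumr; apply: eq_bigr => i _; rewrite mulr_sumr.
  by apply: eq_bigr => j _; rewrite exprMn mulrAC.
have : (l ^+ 2 / (4 * k)) *
    \sum_(i < n) \sum_(j < n | (i < j)%N) c i j ^+ 2 <= (l ^+ 2 / (4 * k)) * 2.
  by rewrite ler_wpM2l// divr_ge0 ?sqr_ge0 ?mulr_ge0// ltW.
have -> : (l ^+ 2 / (4 * k)) * 2 = k * t ^+ 2 / 2 by rewrite /l; field; rewrite gt_eqF.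
have -> : l * t = k * t ^+ 2 by rewrite /l; ring.
lra.
Qed.

(** * Entropy bounds and planted cliques *)

Lemma deviation_entry (R : realType) (n : nat) (p : R) (A : 'M[R]_n) i j :
  (A - p *: (const_mx 1 *m (const_mx 1 : 'cV[R]_n)^T)) i j = A i j - p.
Proof. by rewrite !mxE big_ord1 !mxE !mulr1. Qed.

(** The squared Hilbert-Schmidt norm counts each pair twice, and each zero diagonal entry of [A]
    contributes [p ^+ 2]. *)
Lemma deviation_hs (R : realType) (n : nat) (p : R) (A : 'M[R]_n) :
  (forall i j, A i j = A j i) -> (forall i, A i i = 0) ->
  0 <= deviation p A ->
  deviation p A ^+ 2 <=
    2 * \sum_(i < n) \sum_(j < n | (i < j)%N) (A i j - p) ^+ 2 + n%:R * p ^+ 2.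
Proof.
move=> Asym A0 d0.
have := op_norm_le_hs (A - p *: (const_mx 1 *m (const_mx 1 : 'cV[R]_n)^T)).
rewrite -/(deviation p A) => dh.
have : deviation p A ^+ 2 <=
    hs_norm (A - p *: (const_mx 1 *m (const_mx 1 : 'cV[R]_n)^T)) ^+ 2.
  by rewrite ler_sqr ?nnegrE// sqrtr_ge0.
rewrite sqr_sqrtr; last by do 2![apply: sumr_ge0 => ? _]; exact: sqr_ge0.
move=> /le_trans; apply; rewrite sum_triangle lerD//.
  rewrite mulr_sumr ler_sum// => i _; rewrite mulr_sumr ler_sum// => j _.
  by rewrite !deviation_entry (Asym j i) mulr2n mulrDl mul1r.
rewrite -[n in n%:R]card_ord mulr_natl -sumr_const ler_sum// => i _.
by rewrite deviation_entry A0 sub0r sqrrN.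
Qed.

Lemma phi2_ge (R : realType) (n : nat) (p k th : R) : 0 <= th -> 0 < k ->
  (forall q, 0 <= q <= 1 -> k * (q - p) ^+ 2 <= Ip p q) ->
  ((k * (th ^+ 2 - n%:R * p ^+ 2) / 2)%:E <= phi2 n p th)%E.
Proof.
move=> th0 k0 H; apply: le_ereal_inf_tmp => _ [A [[A01 Asym A0] thA] <-].
have d0 := le_trans th0 thA.
rewrite lee_fin; apply: (@le_trans _ _
    (k * \sum_(i < n) \sum_(j < n | (i < j)%N) (A i j - p) ^+ 2)).
  rewrite -mulrA ler_wpM2l ?(ltW k0)// ler_pdivrMr// [leRHS]mulrC lerBlDr.
  by apply: le_trans (deviation_hs Asym A0 d0); rewrite ler_sqr ?nnegrE.
rewrite mulr_sumr ler_sum// => i _; rewrite mulr_sumr ler_sum// => j _.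
by apply: H; exact: A01.
Qed.

Lemma sum_ltn_ord (R : realType) (n s : nat) : (s <= n)%N ->
  \sum_(i < n) (i < s)%N%:R = s%:R :> R.
Proof.
move=> sn; rewrite -natr_sum -big_mkcond/=; congr (_%:R).
by rewrite (big_ord_narrow sn) sum1_card card_ord.
Qed.

Lemma sum_clique_le (R : realType) (n s : nat) : (s <= n)%N ->
  \sum_(i < n) \sum_(j < n | (i < j)%N) ((i < s) && (j < s))%N%:R <=
    s%:R ^+ 2 / 2 :> R.
Proof.
move=> sn; rewrite ler_pdivlMr//.
have -> : s%:R ^+ 2 = \sum_(i < n) \sum_(j < n) ((i < s) && (j < s))%N%:R :> R.
  rewrite expr2 -{1}(sum_ltn_ord R sn) mulr_suml; apply: eq_bigr => i _.
  rewrite -(sum_ltn_ord R sn) mulr_sumr; apply: eq_bigr => j _.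
  by rewrite -natrM mulnb.
rewrite sum_triangle ler_wpDr//; first by apply: sumr_ge0 => i _.
rewrite mulr_suml ler_sum// => i _; rewrite mulr_suml ler_sum// => j _.
by rewrite (andbC (j < s)%N) -mulr2n mulr_natr.
Qed.

(** The test vector is the normalized indicator of the first [s] vertices. Its quadratic form would
    be [(1 - p) s] if the whole block were 1; the zero diagonal removes exactly 1. *)
Lemma clique_deviation (R : realType) (n s : nat) (p : R) (A : 'M[R]_n) :
  (0 < s <= n)%N -> (forall i, A i i = 0) ->
  (forall i j : 'I_n, (i < s)%N -> (j < s)%N -> i != j -> A i j = 1) ->
  (1 - p) * s%:R - 1 <= deviation p A.
Proof.
move=> /andP[s0 sn] A0 A1.
have s0' : 0 < s%:R :> R by rewrite ltr0n.
pose m (i : 'I_n) : R := (i < s)%N%:R.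
have mm i : m i ^+ 2 = m i by rewrite /m -natrX; case: (_ < _)%N.
pose x : 'cV[R]_n := \col_i (m i / Num.sqrt s%:R).
have xx i j : x i 0 * x j 0 = m i * m j / s%:R.
  rewrite !mxE mulf_div -expr2 sqr_sqrtr//; exact: ltW.
have x1 : l2norm x = 1.
  rewrite /l2norm (_ : \sum_i _ = 1) ?sqrtr1//.
  transitivity (\sum_i m i / s%:R).
    by apply: eq_bigr => i _; rewrite expr2 xx -expr2 mm.
  by rewrite -mulr_suml sum_ltn_ord// divff// gt_eqF.
apply: le_trans (le_op_norm_of_dotp _ x1 x1); rewrite dotp_mulmx.
have -> : (1 - p) * s%:R - 1 =
    \sum_i (\sum_j m i * m j / s%:R * (1 - p) - m i / s%:R).
  rewrite sumrB -mulr_suml sum_ltn_ord// divff ?gt_eqF//; congr (_ - _).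
  transitivity (\sum_i m i * (1 - p)).
    by rewrite -mulr_suml sum_ltn_ord// mulrC.
  apply: eq_bigr => i _; rewrite -mulr_suml -mulr_suml -mulr_sumr sum_ltn_ord//.
  by rewrite mulfK// gt_eqF.
apply: ler_sum => i _; rewrite (bigD1 i)//= [leRHS](bigD1 i)//= addrAC lerD//.
  by rewrite xx deviation_entry A0 -expr2 mm; lra.
apply: ler_sum => j ji; rewrite xx deviation_entry /m.
have [i_s|] := ltnP i s; last by rewrite !mul0r.
have [j_s|] := ltnP j s; last by rewrite mulr0 !mul0r.
by rewrite A1// eq_sym.
Qed.

Lemma Ip1 (R : realType) (p : R) : Ip p 1 = ln p^-1.
Proof. by rewrite /Ip mul1r div1r subrr mul0r addr0. Qed.

Lemma Ipp (R : realType) (p : R) : 0 < p < 1 -> Ip p p = 0.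
Proof.
move=> /andP[p0 p1].
by rewrite /Ip !divff ?ln1 ?mulr0 ?addr0// ?subr_eq0 gt_eqF.
Qed.

(** The competitor has weight 1 inside the clique, at cost [ln p^-1] per pair, and weight [p]
    elsewhere, at no cost. *)
Lemma phi2_le (R : realType) (n s : nat) (p th : R) :
  0 < p < 1 -> (0 < s <= n)%N -> th <= (1 - p) * s%:R - 1 ->
  (phi2 n p th <= (s%:R ^+ 2 / 2 * ln p^-1)%:E)%E.
Proof.
move=> p01 sn ths; move: (p01) (sn) => /andP[p0 p1] /andP[_ sn'].
pose A : 'M[R]_n := \matrix_(i, j)
  (if i == j then 0 else if (i < s)%N && (j < s)%N then 1 else p).
have A0 i : A i i = 0 by rewrite mxE eqxx.
apply: (@le_trans _ _ (Ip_graph p A)%:E).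
  apply: ereal_inf_lbound; exists A => //; split; [split=> [i j|i j|i]|].
  - by rewrite mxE; case: ifP; rewrite ?lexx ?ler01//; case: ifP; rewrite ?lexx ?ler01// !ltW.
  - by rewrite !mxE eq_sym andbC.
  - exact: A0.
  - apply: le_trans ths (clique_deviation _ sn A0 _) => i j i_s j_s ij.
    by rewrite mxE (negbTE ij) i_s j_s.
rewrite lee_fin /Ip_graph.
have L0 : 0 <= ln p^-1 by apply: ln_ge0; rewrite invr_ge1// ?unitfE ?gt_eqF// ltW.
apply: le_trans (ler_wpM2r L0 (sum_clique_le R sn')); rewrite mulr_suml.
apply: ler_sum => i _; rewrite mulr_suml; apply: ler_sum => j ij.
rewrite mxE -val_eqE/= ltn_eqF//; case: ifP => _; first by rewrite Ip1 mul1r.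
by rewrite Ipp// mul0r.
Qed.

(** The event contains every graph in which the first [s] vertices form a clique, and these have
    probability [p] to the number of pairs in the clique. *)
Lemma Gnp_prob_ge (R : realType) (n s : nat) (p th : R) :
  0 < p < 1 -> (0 < s <= n)%N -> th <= (1 - p) * s%:R - 1 ->
  expR (- (s%:R ^+ 2 / 2 * ln p^-1)) <=
    Gnp_prob p [set g : 'M[bool]_n | th <= deviation p (adjacency R g)].
Proof.
move=> p01 sn ths; move: (p01) (sn) => /andP[p0 p1] /andP[_ sn'].
have L0 : 0 <= ln p^-1 by apply: ln_ge0; rewrite invr_ge1// ?unitfE ?gt_eqF// ltW.
pose cl (i j : 'I_n) := (i < s)%N && (j < s)%N.
(* A missing clique edge gets weight 0, so the product of the [F i j] is the mass of the graph times
   the indicator of the clique. *)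
pose F i j b : R := if cl i j then (if b then p else 0) else bernoulli_pmf p b.
apply: (@le_trans _ _ (\sum_(g : 'M[bool]_n | simple_graph g)
    \prod_(i < n) \prod_(j < n | (i < j)%N) F i j (g i j))).
  rewrite sum_simple_graph_prod.
  have -> : \prod_(i < n) \prod_(j < n | (i < j)%N) (F i j true + F i j false) =
      \prod_(i < n) \prod_(j < n | (i < j)%N) expR (- ((cl i j)%:R * ln p^-1)).
    apply: eq_bigr => i _; apply: eq_bigr => j _; rewrite /F; case: (cl i j).
      by rewrite addr0 mul1r lnV ?posrE// opprK lnK.
    by rewrite mul0r oppr0 expR0 /bernoulli_pmf addrC subrK.
  under eq_bigr do rewrite -expR_sum.
  rewrite -expR_sum ler_expR.
  under eq_bigr do rewrite sumrN -mulr_suml.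
  by rewrite sumrN -mulr_suml lerN2 ler_wpM2r// sum_clique_le.
rewrite /Gnp_prob [leRHS]big_mkcondr/=; apply: ler_sum => g gs.
have [H|] := pselect (forall i j : 'I_n, (i < j)%N -> cl i j -> g i j); last first.
  move=> /existsNP[i /existsNP[j /not_implyP[ij /not_implyP[cij gij]]]].
  rewrite (bigD1 i)//= (bigD1 j)//= /F cij (negbTE (introN idP gij)) !mul0r.
  by case: ifP => // _; exact: Gnp_pmf_ge0.
have gsym i j : g i j = g j i by move: gs => /andP[/eqP gT _]; rewrite -{1}gT mxE.
have g0 i : g i i = false by move: gs => /andP[_ /forallP/(_ i)/negbTE].
rewrite ifT; last first.
  rewrite inE /=; apply: le_trans ths (clique_deviation _ sn _ _) => [i|i j i_s j_s ij].
    by rewrite mxE g0.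
  rewrite mxE; suff -> : g i j by [].
  have [lij|lji|/val_inj eij] := ltngtP i j.
  - by apply: H; rewrite // /cl i_s.
  - by rewrite gsym; apply: H; rewrite // /cl i_s j_s.
  - by rewrite eij eqxx in ij.
rewrite /Gnp_pmf le_eqVlt; apply/orP; left; apply/eqP.
apply: eq_bigr => i _; apply: eq_bigr => j ij; rewrite /F.
by case: ifP => // /(H _ _ ij) ->.
Qed.

(** * Lattice net and upper tail *)

(** Each coordinate is a sign and a magnitude in units of [1 / (k sqrt n)]. The magnitudes of a
    rounded unit vector sum to at most [n k], so this bounded range suffices and the codes form a
    finite type. *)
Definition lattice_code (n k : nat) : finType :=
  {ffun 'I_n -> bool * 'I_(n * k).+1}.

Definition lattice_point (R : realType) (n k : nat) (f : lattice_code n k) :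
    'cV[R]_n :=
  \col_i ((-1) ^+ (f i).1 * (f i).2%:R / (k%:R * Num.sqrt n%:R)).

(** The first condition controls the number of codes; the second keeps the coefficients small enough
    for the Chernoff bound. *)
Definition lattice_net (R : realType) (n k : nat) (f : lattice_code n k) : bool :=
  (\sum_i (f i).2 <= n * k)%N && (l2norm (lattice_point R f) <= 1).

(* The weight [2^(nk - sum_i b_i)] is at least 1 on the net and factorizes over
   coordinates. *)
Lemma card_lattice_net (R : realType) (n k : nat) :
  #|@lattice_net R n k|%:R <= expR (n%:R * (k%:R + 2)) :> R.
Proof.
pose w (b : 'I_(n * k).+1) : R := 2^-1 ^+ b.
have w0 b : 0 <= w b by rewrite exprn_ge0// invr_ge0.
apply: (@le_trans _ _ (\sum_(f : lattice_code n k) 2 ^+ (n * k) * \prod_i w (f i).2)).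
  rewrite -sum1_card natr_sum big_mkcond/=; apply: ler_sum => f _.
  case: ifPn => [/andP[fs _]|_]; last first.
    by rewrite mulr_ge0 ?exprn_ge0// prodr_ge0.
  by rewrite -expr_sum exprVn -expfB_cond ?exprn_ege1 ?ler1n ?pnatr_eq0.
rewrite -mulr_sumr -(bigA_distr_bigA (fun (i : 'I_n) (z : bool * 'I_(n * k).+1) => w z.2)) /=.
have geom m : \sum_(j < m) 2^-1 ^+ j <= 2 :> R.
  have -> : \sum_(j < m) 2^-1 ^+ j = 2 - 2 * 2^-1 ^+ m :> R.
    elim: m => [|m IH]; first by rewrite big_ord0 expr0; ring.
    by rewrite big_ord_recr/= IH exprS; field.
  by rewrite gerBl mulr_ge0// exprn_ge0// invr_ge0.
(* Two signs, each with a geometric series of sum at most 2. The total is then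
   [2^(nk) 4^n = 2^(n(k+2))], and [2 <= e]. *)
have s4 : \sum_(z : bool * 'I_(n * k).+1) w z.2 <= 4.
  rewrite -(pair_bigA _ (fun (_ : bool) j => w j))/= big_bool/=.
  by have := geom (n * k).+1; rewrite /w; lra.
apply: (@le_trans _ _ (2 ^+ (n * k) * 4 ^+ n)).
  rewrite ler_wpM2l ?exprn_ge0// -[n in 4 ^+ n]card_ord -prodr_const.
  by apply: ler_prod => i _; rewrite s4 andbT sumr_ge0.
have -> : (2 ^+ (n * k) * 4 ^+ n : R) = 2 ^+ (n * (k + 2)).
  rewrite (_ : 4 = 2 ^+ 2 :> R); last by rewrite -natrX.
  by rewrite -exprM -exprD mulnDr (mulnC 2%N).
have -> : n%:R * (k%:R + 2) = (n * (k + 2))%:R * 1 :> R by rewrite mulr1 natrM natrD.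
rewrite expRM_natl.
by apply: lerXn2r; rewrite ?nnegrE ?expR_ge0//; have := expR_ge1Dx (1 : R).
Qed.

Definition lattice_round (R : realType) (n k : nat) (x : 'cV[R]_n) :
    lattice_code n k :=
  [ffun i => (x i 0 < 0, inord (Num.truncn (`|x i 0| * (k%:R * Num.sqrt n%:R))))].

(** Truncation towards zero moves each coordinate by at most [1 / (k sqrt n)], hence the vector by
    at most [1 / k], and does not increase the norm. By Cauchy-Schwarz the absolute values of the
    coordinates sum to at most [sqrt n], which bounds the sum of the magnitudes. *)
Lemma lattice_roundP (R : realType) (n k : nat) (x : 'cV[R]_n) :
  (0 < n)%N -> (0 < k)%N -> l2norm x = 1 ->
  l2norm (x - lattice_point R (lattice_round k x)) <= k%:R^-1 /\
  lattice_net R (lattice_round k x).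
Proof.
move=> n0 k0 x1.
set f := lattice_round k x; set y := lattice_point R f.
have sn0 : 0 < Num.sqrt n%:R :> R by rewrite sqrtr_gt0 ltr0n.
set c := k%:R * Num.sqrt n%:R : R.
have c0 : 0 < c by rewrite mulr_gt0// ltr0n.
pose b i := Num.truncn (`|x i 0| * c).
have bP i : (b i)%:R <= `|x i 0| * c < (b i).+1%:R.
  by apply: truncn_itv; rewrite mulr_ge0 ?(ltW c0).
have bs : (\sum_i b i <= n * k)%N.
  rewrite -(ler_nat R) natr_sum.
  apply: (@le_trans _ _ (\sum_i `|x i 0| * c)).
    by apply: ler_sum => i _; case/andP: (bP i).
  rewrite -mulr_suml.
  have : \sum_i `|x i 0| <= Num.sqrt n%:R.
    have s0 : 0 <= \sum_i `|x i 0| by apply: sumr_ge0.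
    rewrite -ler_sqr ?nnegrE ?(ltW sn0)// sqr_sqrtr//.
    have := sum_cauchy_schwarz (fun i => `|x i 0|) (fun _ => 1 : R).
    under eq_bigr do rewrite mulr1.
    move=> /le_trans; apply; rewrite expr1n sumr_const card_ord.
    under eq_bigr do rewrite real_normK ?num_real//.
    by rewrite -l2norm_sqr x1 expr1n mul1r.
  move=> /(ler_wpM2r (ltW c0)) /le_trans; apply.
  by rewrite /c mulrCA -expr2 sqr_sqrtr// natrM mulrC.
(* By [bs] each magnitude lies in range, so [inord] returns it and not its default. *)
have fb i : (f i).2 = b i :> nat.
  rewrite ffunE /= inordK// ltnS; apply: leq_trans bs.
  by rewrite (bigD1 i)//= leq_addr.
have yE i : y i 0 = (-1) ^+ (x i 0 < 0)%R * ((b i)%:R / c).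
  by rewrite mxE fb ffunE/= mulrA.
have be i : (b i)%:R / c <= `|x i 0| by rewrite ler_pdivrMr//; case/andP: (bP i).
have bg i : `|x i 0| - (b i)%:R / c <= c^-1.
  rewrite -[X in _ <= X]mul1r lerBlDr -mulrDl ler_pdivlMr// nat1r.
  by case/andP: (bP i) => _ /ltW.
have b0 i : 0 <= (b i)%:R / c by rewrite divr_ge0// ltW.
split; last first.
  rewrite /lattice_net; under eq_bigr do rewrite fb.
  rewrite bs /= -[leRHS]x1; apply: ler_wsqrtr; apply: ler_sum => i _.
  rewrite -/y yE exprMn sqrr_sign mul1r -(real_normK (num_real (x i 0))).
  by rewrite ler_sqr ?nnegrE.
have -> : k%:R^-1 = Num.sqrt (\sum_(i < n) c^-1 ^+ 2).
  rewrite sumr_const card_ord -[X in Num.sqrt X]mulr_natl sqrtrM// sqrtr_sqr.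
  rewrite ger0_norm ?invr_ge0 ?ltW//.
  by rewrite /c; field; rewrite !gt_eqF ?ltr0n.
apply: ler_wsqrtr; apply: ler_sum => i _.
rewrite [(x - y) i 0]mxE [(- y) i 0]mxE yE {1}[x i 0]numEsign -mulrBr exprMn sqrr_sign mul1r.
by rewrite ler_sqr ?nnegrE ?invr_ge0 ?(ltW c0)// subr_ge0.
Qed.

(** Over all ordered pairs the sum is twice the squared product of the norms plus [dotp y x ^+ 2],
    hence at most 4; dropping the nonnegative diagonal and halving gives 2. *)
Lemma sum_sym_coef_le (R : realType) (n : nat) (y x : 'cV[R]_n) :
  l2norm y <= 1 -> l2norm x <= 1 ->
  \sum_(i < n) \sum_(j < n | (i < j)%N) (y i 0 * x j 0 + y j 0 * x i 0) ^+ 2 <= 2.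
Proof.
move=> y1 x1.
pose c i j := (y i 0 * x j 0 + y j 0 * x i 0) ^+ 2.
have : \sum_i \sum_j c i j =
    2 * (l2norm y ^+ 2 * l2norm x ^+ 2 + dotp y x ^+ 2).
  have prodE (u v w z : 'cV[R]_n) : \sum_i \sum_j (u i 0 * v i 0) * (w j 0 * z j 0) =
      dotp u v * dotp w z.
    by rewrite mulr_suml; apply: eq_bigr => i _; rewrite mulr_sumr.
  rewrite -!dotp_self mulrDr expr2 mulr2n !mulrDl !mul1r {2}(mulrC (dotp y y)).
  rewrite -!prodE -!big_split/=; apply: eq_bigr => i _; rewrite -!big_split/=.
  by apply: eq_bigr => j _; rewrite /c; ring.
rewrite sum_triangle.
have : 0 <= \sum_i c i i by apply: sumr_ge0 => i _; exact: sqr_ge0.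
have -> : \sum_(i < n) \sum_(j < n | (i < j)%N) (c i j + c j i) =
    2 * \sum_(i < n) \sum_(j < n | (i < j)%N) c i j.
  rewrite mulr_sumr; apply: eq_bigr => i _; rewrite mulr_sumr.
  by apply: eq_bigr => j _; rewrite /c; ring.
have l2 : l2norm y ^+ 2 * l2norm x ^+ 2 <= 1.
  by rewrite mulr_ile1 ?sqr_ge0// expr_le1// l2norm_ge0.
have : dotp y x ^+ 2 <= 1.
  by rewrite /dotp (le_trans (sum_cauchy_schwarz _ _))// -!l2norm_sqr.
move: l2; rewrite -/(c _ _); lra.
Qed.

(** Grouping by edges turns the form, for a random graph, into a sum of independent centred terms;
    the zero diagonal leaves a deterministic remainder. *)
Lemma dotp_deviation (R : realType) (n : nat) (p : R) (A : 'M[R]_n)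
    (y x : 'cV[R]_n) :
  (forall i j, A i j = A j i) -> (forall i, A i i = 0) ->
  dotp y ((A - p *: (const_mx 1 *m (const_mx 1 : 'cV[R]_n)^T)) *m x) =
  \sum_(i < n) \sum_(j < n | (i < j)%N)
     (y i 0 * x j 0 + y j 0 * x i 0) * (A i j - p) - p * dotp y x.
Proof.
move=> Asym A0; rewrite dotp_mulmx sum_triangle; congr (_ + _).
  apply: eq_bigr => i _; apply: eq_bigr => j _.
  by rewrite !deviation_entry (Asym j i); ring.
rewrite /dotp -mulNr mulr_sumr; apply: eq_bigr => i _.
by rewrite deviation_entry A0; ring.
Qed.

(** Rounding at scale [1 / m] costs the factor [1 - 3 / m] and the diagonal remainder costs at most
    [p]. The union bound runs over pairs of net points, whence the factor 2 in the entropy term. *)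
Lemma Gnp_upper_tail (R : realType) (n m : nat) (p k th : R) :
  (0 < n)%N -> (0 < m)%N -> 0 < p < 1 -> 0 < k -> 0 < th ->
  (forall q, 0 <= q <= 1 -> k * (q - p) ^+ 2 <= Ip p q) ->
  0 <= (1 - 3 * m%:R^-1) * th - p ->
  Gnp_prob p [set g : 'M[bool]_n | th <= deviation p (adjacency R g)] <=
  expR (2 * n%:R * (m%:R + 2) - k * ((1 - 3 * m%:R^-1) * th - p) ^+ 2 / 2).
Proof.
move=> n0 m0 p01 k0 th0 H t0; move: (p01) => /andP[p0 p1].
set t := _ - p in t0 *.
pose N := [predX @lattice_net R n m & @lattice_net R n m].
pose c (z : lattice_code n m * lattice_code n m) (i j : 'I_n) : R :=
  let y := lattice_point R z.1 in let x := lattice_point R z.2 in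
  y i 0 * x j 0 + y j 0 * x i 0.
pose F z : set 'M[bool]_n := [set g : 'M[bool]_n | t <=
  \sum_(i < n) \sum_(j < n | (i < j)%N) c z i j * ((g i j)%:R - p)].
have NP z : N z -> l2norm (lattice_point R z.1) <= 1 /\ l2norm (lattice_point R z.2) <= 1.
  by move=> /andP[/andP[_ ?] /andP[_ ?]].
apply: (@le_trans _ _ (#|N|%:R * expR (- (k * t ^+ 2 / 2)))).
  apply: (@Gnp_prob_union _ _ _ _ _ N _ F) => // [g gs /= thg|z /NP[z1 z2]]; last first.
    exact/Gnp_chernoff/sum_sym_coef_le.
  have gsym i j : adjacency R g i j = adjacency R g j i.
    by move: gs => /andP[/eqP gT _]; rewrite !mxE -{1}gT mxE.
  have g0 i : adjacency R g i i = 0.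
    by move: gs => /andP[_ /forallP/(_ i)/negbTE gi]; rewrite mxE gi.
  have m1 : m%:R^-1 <= 1 :> R by rewrite invf_le1 ?ltr0n// ler1n.
  have [|||y [x [y1 x1]]] := @op_norm_round R n
      (adjacency R g - p *: (const_mx 1 *m (const_mx 1 : 'cV[R]_n)^T))
      m%:R^-1 (fun x => lattice_point R (lattice_round m x)) _ m1 _ _.
  - by rewrite invr_gt0 ltr0n.
  - exact: lt_le_trans th0 thg.
  - by move=> x x1; have [? /andP[_ ?]] := lattice_roundP n0 m0 x1.
  rewrite dotp_deviation// => Hd.
  have [_ yN] := lattice_roundP n0 m0 y1; have [_ xN] := lattice_roundP n0 m0 x1.
  exists (lattice_round m y, lattice_round m x); first exact/andP.
  rewrite /F /c /=; move: yN xN => /andP[_ yN] /andP[_ xN].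
  set u := lattice_point _ _ in yN Hd *; set v := lattice_point _ _ in xN Hd *.
  set S := \sum_(i < n) _ in Hd.
  have uv : - dotp u v <= 1.
    rewrite -mulN1r -dotpZl; apply: le_trans (dotp_le _ _) _.
    by rewrite l2normZ normrN1 mul1r mulr_ile1 ?l2norm_ge0.
  have e0 : 0 <= 1 - 3 * m%:R^-1 :> R.
    have : 0 <= (1 - 3 * m%:R^-1) * th by move: t0; rewrite /t; lra.
    by rewrite pmulr_lge0.
  have <- : S = \sum_(i < n) \sum_(j < n | (i < j)%N)
      (u i 0 * v j 0 + u j 0 * v i 0) * ((g i j)%:R - p).
    by apply: eq_bigr => i _; apply: eq_bigr => j _; rewrite [adjacency _ _ _ _]mxE.
  have := ler_wpM2l e0 thg.
  have := ler_wpM2l (ltW p0) uv; rewrite mulr1 mulrN /t; move: Hd thg; rewrite /deviation; lra.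
rewrite -[X in _ * X]/(expR _) expRD ler_wpM2r ?expR_ge0//.
have := card_lattice_net R n m => Nb.
rewrite cardX natrM.
have -> : 2 * n%:R * (m%:R + 2) = n%:R * (m%:R + 2) + n%:R * (m%:R + 2) :> R by ring.
by rewrite expRD ler_pM.
Qed.

(** * Asymptotics *)

Lemma Ip_ge_sqr_ln (R : realType) (p q h : R) : 0 < h < 1 ->
  0 < p -> 64 * p <= 1 -> 2 * ln (8 / h) <= h * ln p^-1 -> 0 < ln p^-1 ->
  0 <= q <= 1 -> (1 - h) * ln p^-1 * (q - p) ^+ 2 <= Ip p q.
Proof.
move=> /andP[h0 h1] p0 p64 hL L0 q01.
set L := ln p^-1 in hL L0 *.
have k0 : 0 < (1 - h) * L by rewrite mulr_gt0// subr_gt0.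
have kL : (1 - h) * L <= L by nra.
(* From [ln x <= x] at [x = 1 / sqrt p] one gets [L <= 2 / sqrt p], so the left side is at most
   [8 sqrt p]; this is where 64 comes from. *)
have pL : 4 * L * p <= 1.
  set a := Num.sqrt p.
  have a0 : 0 < a by rewrite sqrtr_gt0.
  have pE : p = a ^+ 2 by rewrite sqr_sqrtr// ltW.
  have a8 : 8 * a <= 1.
    rewrite -(@expr_le1 _ 2)//; last by rewrite mulr_ge0// ltW.
    by rewrite exprMn -pE -natrX.
  have : L <= 2 * a^-1.
    rewrite /L pE -exprVn lnXn ?invr_gt0// -[leLHS]mulr_natl ler_wpM2l//.
    by apply: ltW; apply: ln_sublinear; rewrite invr_gt0.
  move=> /(ler_wpM2r (ltW p0)); rewrite {2}pE.
  have -> : 2 / a * a ^+ 2 = 2 * a by field; rewrite gt_eqF.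
  lra.
apply: Ip_ge_sqr => //; first by rewrite p0; lra.
  by have := ler_wpM2r (ltW p0) kL; lra.
(* The logarithmic loss must fit into [h L - 1]: the term [ln (h L / 2)] takes at most
   [h L / 2 - 1], and [ln (8 / h)] the other half by [hL]. *)
have : ln (4 * ((1 - h) * L)) <= ln (h * L / 2) + ln (8 / h).
  rewrite -lnM ?posrE ?divr_gt0 ?mulr_gt0// ler_ln ?posrE
    ?mulr_gt0 ?divr_gt0 ?mulr_gt0 ?invr_gt0 ?subr_gt0//.
  have -> : h * L / 2 * (8 / h) = 4 * L by field; rewrite gt_eqF.
  lra.
have : ln (h * L / 2) <= h * L / 2 - 1.
  by apply: ln_le_subr1; rewrite divr_gt0 ?mulr_gt0.
rewrite -/L; lra.
Qed.

Lemma rateE (R : realType) (n : nat) (p d : R) :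
  rate n p d = (d * n%:R * p) ^+ 2 * ln p^-1 / 2.
Proof. by rewrite /rate; field. Qed.

(** Up to truncation, [s] is [(th + 1) / (1 - p)]. The added 1, the division by [1 - p] and the
    rounding up each cost about a factor [1 + h], so [s <= (1 + 4 h) th], whose square is within
    [1 + 10 h]. *)
Lemma clique_size (R : realType) (n : nat) (p h th : R) :
  0 < h -> 10 * h <= 1 -> 0 < p -> 2 * p <= h -> 1 <= h * th -> 2 * th <= n%:R ->
  exists s : nat, [/\ (0 < s <= n)%N, th <= (1 - p) * s%:R - 1 &
    s%:R ^+ 2 <= (1 + 10 * h) * th ^+ 2].
Proof.
move=> h0 h1 p0 ph hth thn.
have th0 : 0 < th by rewrite -(pmulr_rgt0 _ h0); lra.
have p1 : 0 < 1 - p by lra.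
set z := (th + 1) / (1 - p).
have z0 : 0 <= z by rewrite divr_ge0//; lra.
have zth : z <= (1 + h) ^+ 2 * th.
  have q1 : 1 <= (1 + h) * (1 - p) by nra.
  have hth1 : 0 <= (1 + h) * th by rewrite mulr_ge0 ?(ltW th0)//; lra.
  by rewrite ler_pdivrMr//; have := ler_wpM2l hth1 q1; lra.
have hh : h ^+ 2 * th <= h * th by rewrite ler_wpM2r ?(ltW th0)//; nra.
have /andP[tz zt] := truncn_itv z0.
have sth : (Num.truncn z).+1%:R <= (1 + 4 * h) * th.
  by rewrite -natr1; lra.
exists (Num.truncn z).+1; split.
- rewrite ltn0Sn /= -(ler_nat R); apply: le_trans sth _; nra.
- rewrite lerBrDr mulrC -ler_pdivrMr// ltW//.
- apply: (@le_trans _ _ (((1 + 4 * h) * th) ^+ 2)).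
    by rewrite ler_sqr ?nnegrE//; nra.
  by rewrite exprMn ler_wpM2r ?sqr_ge0//; nra.
Qed.

(** The deterministic and probabilistic bounds share one relative error [10 h], so both limits
    follow from a single eventual statement. *)
Definition sandwiched (R : realType) (n : nat) (p d h : R) : Prop :=
  let th := d * n%:R * p in let r := rate n p d in
  let P := Gnp_prob p
    [set g : 'M[bool]_n | th <= deviation p (adjacency R g)] in
  [/\ 0 < r,
   (((1 - 10 * h) * r)%:E <= phi2 n p th)%E,
   (phi2 n p th <= ((1 + 10 * h) * r)%:E)%E,
   P <= expR (- ((1 - 10 * h) * r)) & expR (- ((1 + 10 * h) * r)) <= P].

Lemma sandwich (R : realType) (n m : nat) (p d h : R) :
  0 < h -> 10 * h <= 1 -> (0 < n)%N -> (0 < m)%N -> 3 * m%:R^-1 <= h ->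
  0 < p -> 64 * p <= 1 -> 2 * p <= h ->
  2 * ln (8 / h) <= h * ln p^-1 -> 1 <= ln p^-1 ->
  let th := d * n%:R * p in
  0 < th -> 1 <= h * th -> 2 * th <= n%:R ->
  4 * n%:R * (m%:R + 2) <= h * th ^+ 2 ->
  sandwiched n p d h.
Proof.
move=> h0 h1 n0 m0 mh p0 p64 ph hL L1 th th0 hth thn ent.
rewrite /sandwiched rateE -/th.
have p01 : 0 < p < 1 by rewrite p0; lra.
have H q : 0 <= q <= 1 -> (1 - h) * ln p^-1 * (q - p) ^+ 2 <= Ip p q.
  by apply: Ip_ge_sqr_ln => //; [rewrite h0; lra|lra].
set L := ln p^-1 in hL L1 H *.
have k0 : 0 < (1 - h) * L by rewrite mulr_gt0//; lra.
have m2 : 2 <= m%:R + 2 :> R by rewrite lerDr.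
set T := th ^+ 2 * L / 2.
have T0 : 0 < T by rewrite divr_gt0// mulr_gt0 ?exprn_gt0//; lra.
have th2 : 0 <= th ^+ 2 by exact: sqr_ge0.
have up : forall s : R, s ^+ 2 <= (1 + 10 * h) * th ^+ 2 ->
    s ^+ 2 / 2 * L <= (1 + 10 * h) * T.
  move=> s; have L0 : 0 <= L / 2 by lra.
  by move=> /(ler_wpM2r L0); rewrite /T; lra.
have [s [sn ths s2]] := clique_size h0 h1 p0 ph hth thn.
split=> //.
- apply: le_trans (phi2_ge n (ltW th0) k0 H); rewrite lee_fin.
  have np : n%:R * p ^+ 2 <= h * th ^+ 2.
    have : n%:R * p ^+ 2 <= n%:R by rewrite ler_piMr// expr_le1//; lra.
    have : 4 * n%:R * 2 <= 4 * n%:R * (m%:R + 2) :> R by rewrite ler_wpM2l//; lra.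
    lra.
  have : (1 - h) * L * ((1 - h) * th ^+ 2) <= (1 - h) * L * (th ^+ 2 - n%:R * p ^+ 2).
    by rewrite ler_wpM2l ?(ltW k0)//; lra.
  have : (1 - 10 * h) * T <= (1 - h) ^+ 2 * T by rewrite ler_wpM2r ?(ltW T0)//; nra.
  rewrite /T; lra.
- by apply: le_trans (phi2_le p01 sn ths) _; rewrite lee_fin up.
- have tth : (1 - 2 * h) * th <= (1 - 3 * m%:R^-1) * th - p.
    have : (1 - h) * th <= (1 - 3 * m%:R^-1) * th by rewrite ler_wpM2r ?(ltW th0)//; lra.
    lra.
  have t0 : 0 <= (1 - 2 * h) * th by rewrite mulr_ge0 ?(ltW th0)//; lra.
  apply: le_trans (Gnp_upper_tail n0 m0 p01 k0 th0 H (le_trans t0 tth)) _.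
  rewrite ler_expR.
  set t := _ - p in tth *.
  have : ((1 - 2 * h) * th) ^+ 2 <= t ^+ 2.
    by rewrite ler_sqr ?nnegrE// (le_trans t0).
  move=> /(ler_wpM2l (ltW k0)).
  have -> : (1 - h) * L * ((1 - 2 * h) * th) ^+ 2 = (1 - h) * (1 - 2 * h) ^+ 2 * T * 2.
    by rewrite /T; field.
  (* The entropy of the net is a fraction [h] of the rate; together with the losses [1 - h] in [k]
     and [1 - 2 h] in the threshold it fits into [10 h]. *)
  have entT : 2 * n%:R * (m%:R + 2) <= h * T.
    have := ler_wpM2l (mulr_ge0 (ltW h0) th2) L1.
    rewrite /T; lra.
  have : (1 - 10 * h) * T <= ((1 - h) * (1 - 2 * h) ^+ 2 - h) * T.
    by rewrite ler_wpM2r ?(ltW T0)//; nra.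
  lra.
- apply: le_trans (Gnp_prob_ge p01 sn ths).
  by rewrite ler_expR lerN2 up.
Qed.

(** [B] is chosen with [h B = 4 (m + 2) + 1], so a threshold of at least [(B + 1) sqrt n] both
    exceeds [1 / h] and dominates the net entropy. The bound [p < 1 / (2C)] makes room for the
    clique inside the [n] vertices. *)
Lemma sandwich_of_small (R : realType) (n m : nat) (p d h C : R) :
  let B := (4 * (m%:R + 2) + 1) / h in
  0 < h -> 10 * h <= 1 -> (0 < n)%N -> (0 < m)%N -> 3 * m%:R^-1 <= h ->
  0 < p -> p < 64^-1 -> p < h / 2 -> p < (2 * C)^-1 -> 0 < C -> d <= C ->
  1 <= ln p^-1 -> 2 * ln (8 / h) / h <= ln p^-1 ->
  (B + 1) * Num.sqrt n%:R <= d * n%:R * p ->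
  sandwiched n p d h.
Proof.
move=> B h0 h1 n0 m0 mh p0 p64 ph pC C0 dC L1 LK Bth.
have hB : h * B = 4 * (m%:R + 2) + 1 by rewrite /B; field; rewrite gt_eqF.
have hB1 : 1 <= h * B by rewrite hB; have := ler0n R m; lra.
have B0 : 0 < B by rewrite -(pmulr_rgt0 _ h0); lra.
move: B hB hB1 B0 Bth => B hB hB1 B0 Bth.
have n1 : 1 <= n%:R :> R by rewrite ler1n.
have sn1 : 1 <= Num.sqrt n%:R :> R by rewrite -[leLHS]sqrtr1 ler_wsqrtr.
have Bth' : B + 1 <= d * n%:R * p.
  by apply: le_trans Bth; rewrite ler_peMr//; lra.
have th0 : 0 < d * n%:R * p by lra.
apply: (@sandwich _ n m) => //.
- lra.
- lra.
- by rewrite [leRHS]mulrC -ler_pdivrMr.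
- by apply: le_trans hB1 _; rewrite ler_wpM2l ?(ltW h0)//; lra.
- move: pC; rewrite -[X in _ < X]mul1r ltr_pdivlMr ?mulr_gt0// => pC.
  have : d * (n%:R * p) <= C * (n%:R * p) by rewrite ler_wpM2r// mulr_ge0// ltW.
  have : n%:R * (p * (2 * C)) <= n%:R by rewrite ler_piMr// ltW.
  lra.
- have B1n : 0 <= (B + 1) * Num.sqrt n%:R by rewrite mulr_ge0//; lra.
  have : ((B + 1) * Num.sqrt n%:R) ^+ 2 <= (d * n%:R * p) ^+ 2.
    by rewrite ler_sqr ?nnegrE// ltW.
  rewrite exprMn sqr_sqrtr// => /(ler_wpM2l (ltW h0)); apply: le_trans.
  have : n%:R * (h * B) <= n%:R * (h * (B + 1) ^+ 2).
    by rewrite ler_wpM2l// ler_wpM2l ?(ltW h0)//; nra.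
  rewrite hB; lra.
Qed.

Lemma near_sandwich (R : realType) (p delta : nat -> R) (h : R) :
  (forall n, 0 < p n < 1) -> p n @[n --> \oo] --> (0 : R) ->
  (forall n, 0 < delta n) -> (exists C : R, forall n, delta n <= C) ->
  delta n * n%:R * p n / Num.sqrt n%:R @[n --> \oo] --> +oo ->
  0 < h -> 10 * h <= 1 ->
  \forall n \near \oo, sandwiched n (p n) (delta n) h.
Proof.
move=> p01 p_to0 delta_gt0 [C dC] delta_large h0 h1.
have C0 : 0 < C by apply: lt_le_trans (delta_gt0 0%N) (dC 0%N).
pose m := (Num.truncn (3 / h)).+1.
have mh : 3 * m%:R^-1 <= h.
  have /andP[_ /ltW] : (Num.truncn (3 / h))%:R <= 3 / h < m%:R.
    by apply: truncn_itv; rewrite divr_ge0// ltW.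
  rewrite !ler_pdivrMr ?ltr0n//; lra.
pose K := Num.max 1 (2 * ln (8 / h) / h).
have small c : 0 < c -> \forall n \near \oo, p n < c.
  by move=> c0; exact: (cvgr_lt (0 : R)).
near=> n.
have n0 : (0 < n)%N by near: n; exact: nbhs_infty_gt.
have /andP[p0 p1] := p01 n.
have : K <= ln (p n)^-1.
  (* The condition on [ln p^-1] is restated as the smallness condition [p n < expR (- K)]. *)
  rewrite lnV ?posrE// -[K]opprK lerN2 -[- K]expRK ler_ln ?posrE ?expR_gt0//.
  by apply: ltW; near: n; apply: small; exact: expR_gt0.
rewrite ge_max => /andP[L1 LK].
apply: (@sandwich_of_small _ n m _ _ _ C) => //.
- by near: n; apply: small; rewrite invr_gt0.
- by near: n; apply: small; rewrite divr_gt0.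
- by near: n; apply: small; rewrite invr_gt0 mulr_gt0.
- rewrite -ler_pdivlMr; last by rewrite sqrtr_gt0 ltr0n.
  by near: n; move: delta_large => /cvgryPge; apply.
Unshelve. all: by end_near.
Qed.

Lemma cvg1_of_sandwich (R : realType) (r : nat -> R) :
  (forall h, 0 < h -> 10 * h <= 1 ->
    \forall n \near \oo, 1 - 10 * h <= r n <= 1 + 10 * h) ->
  r n @[n --> \oo] --> (1 : R).
Proof.
move=> H; apply/cvgrPdist_le => e e0.
pose h := Num.min (e / 10) 10^-1.
have h0 : 0 < h by rewrite lt_min divr_gt0//= invr_gt0.
have /andP[he h1] : (h <= e / 10) && (h <= 10^-1) by rewrite -le_min.
near=> n.
have /andP[] : 1 - 10 * h <= r n <= 1 + 10 * h.
  by near: n; apply: H => //; lra.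
by rewrite distrC ler_distl => ? ?; apply/andP; split; lra.
Unshelve. all: by end_near.
Qed.

Theorem theorem1p4 (R : realType) (p delta : nat -> R)
  (p01 : forall n, 0 < p n < 1)
  (p_to0 : p n @[n --> \oo] --> (0 : R))
  (sqrtn_p : Num.sqrt n%:R * p n @[n --> \oo] --> +oo)
  (delta_gt0 : forall n, 0 < delta n)
  (delta_bounded : exists C : R, forall n, delta n <= C)
  (delta_large :
     delta n * n%:R * p n / Num.sqrt n%:R @[n --> \oo] --> +oo) :
  (exists2 eps : nat -> R, eps n @[n --> \oo] --> (0 : R) &
     \forall n \near \oo,
       phi2 n (p n) (delta n * n%:R * p n) =
         ((1 + eps n) * rate n (p n) (delta n))%:E)
  /\
  ((- lne (Gnp_prob (p n) [set g : 'M[bool]_n |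
             (delta n * n%:R * p n <=
              deviation (p n) (adjacency R g))%R])%:E
     * ((rate n (p n) (delta n))^-1)%:E)%E @[n --> \oo] --> (1%:E : \bar R)).
Proof.
have S h := @near_sandwich R p delta h p01 p_to0 delta_gt0 delta_bounded delta_large.
(* One fixed admissible error gives, for large [n], finiteness of [phi2] and positivity of the rate
   and of the probability. *)
have h20 : 0 < 20^-1 :> R by rewrite invr_gt0.
have h201 : 10 * 20^-1 <= 1 :> R by lra.
split.
  pose f n := phi2 n (p n) (delta n * n%:R * p n).
  have ffin n a b : (a%:E <= f n)%E -> (f n <= b%:E)%E -> f n \is a fin_num.
    move=> lo up; rewrite fin_real// (lt_le_trans (ltNyr a) lo)/=.
    exact: le_lt_trans up (ltry b).
  (* [fine] sends an infinite value to 0, so the required identity is claimed only once [phi2] is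
     finite. *)
  exists (fun n => fine (f n) / rate n (p n) (delta n) - 1).
    rewrite -[X in _ --> X](subrr (1 : R)); apply: cvgB; last exact: cvg_cst.
    apply: cvg1_of_sandwich => h h0 h1.
    apply: filterS (S h h0 h1) => n [r0 lo up _ _].
    by rewrite ler_pdivlMr// ler_pdivrMr// -!lee_fin fineK ?(ffin _ _ _ lo up)// lo up.
  apply: filterS (S _ h20 h201) => n [r0 lo up _ _].
  by rewrite addrC subrK divfK ?gt_eqF// fineK// (ffin _ _ _ lo up).
pose P n := Gnp_prob (p n) [set g : 'M[bool]_n |
  delta n * n%:R * p n <= deviation (p n) (adjacency R g)].
(* Once the probability is positive, the extended logarithm is the real one and the limit can be
   taken in [R]. *)
have E : \forall n \near \oo, (- ln (P n) / rate n (p n) (delta n))%:E =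
    (- lne (P n)%:E * ((rate n (p n) (delta n))^-1)%:E)%E.
  apply: filterS (S _ h20 h201) => n [r0 _ _ _ lo].
  by rewrite lne_EFin// (lt_le_trans (expR_gt0 _) lo).
apply: cvg_trans (near_eq_cvg E) _.
apply: cvg_EFin; first by near=> n.
apply: cvg1_of_sandwich => h h0 h1.
apply: filterS (S h h0 h1) => n [r0 _ _ up lo].
have P0 : 0 < P n := lt_le_trans (expR_gt0 _) lo.
rewrite /= ler_pdivlMr// ler_pdivrMr//.
rewrite lerNr lerNl -[X in _ <= X]expRK -[X in _ && (X <= _)]expRK.
by rewrite !ler_ln ?posrE ?expR_gt0// up lo.
Unshelve. all: by end_near.
Qed.
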